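(* Let $1\le p<\infty$ and $0\le\lambda<1$, and let $\beta\in\mathbb R$. If the Hilbert transform $H$ on $\mathbb R$ is bounded from $\mathcal L^{p,\lambda}(|x|^\beta)$ to $W\mathcal L^{p,\lambda}(|x|^\beta)$, then $\lambda-1<\beta<\lambda+p-1$.
   Context: The setting is $\mathbb R$ (dimension one). For a nonnegative measurable $w$ and a set $A$, $w(A)=\int_A w$. $Hf(x)=\frac1\pi\,\mathrm{p.v.}\int_{\mathbb R}\frac{f(y)}{x-y}\,dy$. Boundedness means that $H$ is defined on $\mathcal L^{p,\lambda}(w)$ and there is $C$ with $\|Hf\|_{W\mathcal L^{p,\lambda}(w)}\le C\|f\|_{\mathcal L^{p,\lambda}(w)}$ for all $f\in\mathcal L^{p,\lambda}(w)$, with $w=|x|^\beta$. Morrey norm (with $B(x,r)=(x-r,x+r)$): $\|f\|_{\mathcal L^{p,\lambda}(w)}=\sup_{x\in\mathbb R,\,r>0}\big(\frac1{r^\lambda}\int_{B(x,r)}|f|^p w\big)^{1/p}$, and $\mathcal L^{p,\lambda}(w)$ is the set of measurable $f$ with finite norm. Weak Morrey norm: $\|f\|_{W\mathcal L^{p,\lambda}(w)}=\sup_{x\in\mathbb R,\,r>0,\,t>0}\big(\frac{t^p\,w(\{y\in B(x,r):|f(y)|>t\})}{r^\lambda}\big)^{1/p}$, and $W\mathcal L^{p,\lambda}(w)$ is the set of measurable $f$ for which this is finite.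
   Formalization: The formal theorem excludes the single case p = 1, λ = 0, β = 0, where the statement fails: H is bounded from L¹ to weak L¹ (Kolmogorov), but the conclusion would read 0 < 0. *)

(* Defs.v *)
From HB Require Import structures.
From mathcomp Require Import all_boot all_order all_algebra.
From mathcomp Require Import all_classical all_reals all_analysis.

Set Implicit Arguments.
Unset Strict Implicit.
Unset Printing Implicit Defensive.

Import Order.TTheory GRing.Theory Num.Theory.
Import numFieldNormedType.Exports.

Local Open Scope classical_set_scope.
Local Open Scope ring_scope.

(* At the origin [powR] gives a finite junk value when [beta < 0]; a single
   point is Lebesgue-negligible, so no integral below is affected. *)
Definition power_weight (R : realType) (beta : R) : R -> R :=
  fun x => `|x| `^ beta.

Definition weighted_measure (R : realType) (w : R -> R) (A : set R) : \bar R :=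
  (\int[lebesgue_measure]_(y in A) (w y)%:E)%E.

Definition morrey_norm (R : realType) (p lambda : R) (w f : R -> R) : \bar R :=
  ereal_sup [set z | exists x r : R, 0 < r /\
    z = ((((r `^ lambda)^-1)%:E *
          \int[lebesgue_measure]_(y in ball x r) (`|f y| `^ p * w y)%:E)
         `^ p^-1)%E].

Definition morrey_space (R : realType) (p lambda : R) (w : R -> R) :
    set (R -> R) :=
  [set f | measurable_fun setT f /\ (morrey_norm p lambda w f < +oo)%E].

Definition weak_morrey_norm (R : realType) (p lambda : R) (w f : R -> R) :
    \bar R :=
  ereal_sup [set z | exists x r t : R, [/\ 0 < r, 0 < t &
    z = (((t `^ p / r `^ lambda)%:E *
          weighted_measure w [set y | ball x r y /\ (t < `|f y|)%R])
         `^ p^-1)%E]].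

Definition truncated_integral (R : realType) (f : R -> R) (x eps : R) : R :=
  \int[lebesgue_measure]_(y in [set y | eps < `|x - y|]) (f y / (x - y)).

(* A total function: its value is meaningful only where the principal value
   exists, in the sense of [hilbert_exists_at]. *)
Definition hilbert (R : realType) (f : R -> R) (x : R) : R :=
  pi^-1 * lim (truncated_integral f x eps @[eps --> 0^'+]).

(* Integrability of the truncations has to be required separately, because
   the real-valued integral of a non-integrable function is a junk value. *)
Definition hilbert_exists_at (R : realType) (f : R -> R) (x : R) : Prop :=
  (forall eps : R, 0 < eps ->
     lebesgue_measure.-integrable [set y | eps < `|x - y|]
       (fun y => (f y / (x - y))%:E)) /\
  cvg (truncated_integral f x eps @[eps --> 0^'+]).

Definition hilbert_defined (R : realType) (f : R -> R) : Prop :=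
  {ae lebesgue_measure, forall x : R, hilbert_exists_at f x}.

Definition hilbert_weak_bounded (R : realType) (p lambda : R) (w : R -> R) :
    Prop :=
  (forall f, morrey_space p lambda w f -> hilbert_defined f) /\
  exists C : R, 0 <= C /\
    forall f, morrey_space p lambda w f ->
      (weak_morrey_norm p lambda w (hilbert f)
         <= C%:E * morrey_norm p lambda w f)%E.

(* Main.v *)
Require Import Defs.
From mathcomp Require Import all_boot all_order all_algebra.
From mathcomp Require Import all_classical all_reals all_analysis.
From mathcomp Require Import measurable_realfun ring lra.

Set Implicit Arguments.
Unset Strict Implicit.
Unset Printing Implicit Defensive.

Import Order.TTheory GRing.Theory Num.Theory.
Import numFieldNormedType.Exports.
Local Open Scope classical_set_scope.
Local Open Scope ring_scope.

(** Both inequalities are obtained by contraposition, from one family of test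
    functions, f = y^alpha on a segment [a, b] of the positive half-line and 0
    elsewhere.  The segment spans the length L = ln b - ln a on the
    logarithmic scale, and L tends to infinity.

    Off its support, H f is an ordinary integral with a kernel of constant
    sign, hence without cancellation.  If |x - y| <= 2 y^(alpha + 1) on the
    support, then y^alpha / |x - y| >= 1 / (2 y), and |H f(x)| is at least
    L / (2 pi) ([hilbert_truncated_power_ge]).  This happens at every x of an
    interval E of length 1 in two cases:
    - alpha = 0, [a, b] = [1, e^L], E = (0, 1), where |x - y| <= y;
    - alpha = -1, [a, b] = [e^(-L), 1], E = (1, 2), where |x - y| <= 2.
    When the weight is at least 1 on E, the weak Morrey norm of H f is
    therefore at least a constant times L.  The first case serves for
    beta <= lambda - 1 (so beta < 0) and the second for
    beta >= lambda + p - 1 (so beta >= 0).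

    The Morrey norm of f grows more slowly.  In both cases
    |f|^p |y|^beta is at most y^(lambda - 1) on the support.
    - For lambda > 0, the integral of y^(lambda - 1) over a ball of radius r
      is O(r^lambda) by subadditivity of t^lambda
      ([integral_ball_powR_le]), so the norms stay bounded.
    - For lambda = 0, the integral of 1 / y over the support is L, and the
      norms are O(L^(1/p)), which is o(L) when p > 1.
    Boundedness of H would thus give L = O(L^theta) with theta < 1
    ([hilbert_weak_unbounded]).

    Two cases with lambda = 0 are left.  If beta <= -1, then |x|^beta has
    infinite mass on (0, 1), so that a single f already has H f of infinite
    weak norm.  If p = 1 and beta >= 0, excluding p = 1, lambda = beta = 0
    leaves beta > 0, and the norms are bounded because y^(beta - 1) is integrable on (0, 1). *)

(** * Powers and their integrals *)

Lemma derivable_powR_gt0 (R : realType) (s y : R) : 0 < y ->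
  derivable (@powR R ^~ s) y 1.
Proof. by move=> y0; apply: derivable_powR; rewrite in_itv/= y0. Qed.

Lemma integral_powR_FTC (R : realType) (F : R -> R) (s a b : R) :
  0 < a -> a < b ->
  (forall y : R, 0 < y -> is_derive y (1 : R) F (y `^ s)) ->
  (\int[lebesgue_measure]_(y in `[a, b]) (y `^ s)%:E = (F b - F a)%:E)%E.
Proof.
move=> a0 ab dF; rewrite EFinB.
have cF y : 0 < y -> {for y, continuous F}.
  by move=> y0; apply/differentiable_continuous/derivable1_diffP; case: (dF y y0).
apply: continuous_FTC2 => //.
- apply: derivable_within_continuous => y; rewrite in_itv/= => /andP[ay _].
  by apply: derivable_powR_gt0; exact: lt_le_trans ay.
- split.
  + move=> y; rewrite in_itv/= => /andP[ay _].
    by case: (dF y (lt_trans a0 ay)).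
  + by apply: cvg_at_right_filter; exact: cF.
  + by apply: cvg_at_left_filter; apply: cF; exact: lt_trans ab.
- move=> y; rewrite in_itv/= => /andP[ay _].
  by rewrite derive1E; case: (dF y (lt_trans a0 ay)).
Qed.

Lemma integral_powR (R : realType) (s a b : R) : s != 0 -> 0 < a -> a < b ->
  (\int[lebesgue_measure]_(y in `[a, b]) (y `^ (s - 1))%:E
   = ((b `^ s - a `^ s) / s)%:E)%E.
Proof.
move=> s0 a0 ab.
have dF (y : R) : 0 < y ->
    is_derive y (1 : R) (fun y => s^-1 *: (y `^ s : R^o)) (y `^ (s - 1)).
  move=> y0; have dy := is_derive1_powR s y0.
  apply: is_derive_eq; rewrite /GRing.scale/=.
  by rewrite mulrA mulVf// mul1r.
by rewrite (integral_powR_FTC a0 ab dF) -scalerBr [_ *: _]mulrC.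
Qed.

Lemma integral_powRN1 (R : realType) (a b : R) : 0 < a -> a < b ->
  (\int[lebesgue_measure]_(y in `[a, b]) (y `^ (-1))%:E
   = (ln b - ln a)%:E)%E.
Proof.
move=> a0 ab; apply: integral_powR_FTC => // y y0.
by rewrite powR_inv1 ?ltW//; exact: is_derive1_ln.
Qed.

(** Since s - 1 <= 0, in the splitting
    (a + h)^s = a (a + h)^(s - 1) + h (a + h)^(s - 1)
    each factor (a + h)^(s - 1) is at most a^(s - 1), resp. h^(s - 1). *)
Lemma powRD_le (R : realType) (s a h : R) : 0 < s -> s <= 1 -> 0 < a -> 0 < h ->
  (a + h) `^ s <= a `^ s + h `^ s.
Proof.
move=> s0 s1 a0 h0.
have ah0 : 0 < a + h by rewrite addr_gt0.
have e z : 0 < z -> z `^ s = z * z `^ (s - 1) by move=> z0; rewrite mulr_powRB1 ?ltW.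
have m z : 0 < z -> z <= a + h -> (a + h) `^ (s - 1) <= z `^ (s - 1).
  move=> z0 zah; rewrite -opprB !powRN lef_pV2 ?posrE ?powR_gt0//.
  by rewrite ge0_ler_powR ?nnegrE ?subr_ge0// ltW.
rewrite !e// mulrDl; apply: lerD; rewrite ler_pM2l//; apply: m; lra.
Qed.

(** Refutes an estimate L = O(L^theta): for D > 0, any L above
    D^(1 / (1 - theta)) violates it. *)
Lemma powR_sublinear (R : realType) (D theta : R) : theta < 1 ->
  exists L : R, 0 < L /\ D * L `^ theta < L.
Proof.
move=> t1; have t0 : 0 < 1 - theta by rewrite subr_gt0.
have D1 : 0 < `|D| + 1 by rewrite ltr_pwDr.
set L := (`|D| + 1) `^ (1 - theta)^-1.
have L0 : 0 < L by rewrite powR_gt0.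
exists L; split => //.
have LE : L = (`|D| + 1) * L `^ theta.
  have <- : L `^ (1 - theta) = `|D| + 1.
    by rewrite /L -powRrM mulVf ?gt_eqF// powRr1 ?ltW.
  by rewrite -powRD ?subrK ?powRr1 ?ltW// oner_eq0.
by rewrite [ltRHS]LE ltr_pM2r ?powR_gt0//; have := ler_norm D; lra.
Qed.

(** * The Hilbert transform of truncated powers *)

Definition truncated_power (R : realType) (alpha a b : R) : R -> R :=
  (@powR R ^~ alpha) \_ `[a, b].

Lemma truncated_powerE (R : realType) (alpha a b y : R) : `[a, b]%classic y ->
  truncated_power alpha a b y = y `^ alpha.
Proof. by move=> yab; rewrite /truncated_power patchE mem_set. Qed.

Lemma truncated_power0 (R : realType) (alpha a b y : R) : ~ `[a, b]%classic y ->
  truncated_power alpha a b y = 0.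
Proof. by move=> yab; rewrite /truncated_power patchE memNset. Qed.

Lemma measurable_power_weight (R : realType) (beta : R) :
  measurable_fun setT (power_weight beta).
Proof. by apply: (measurableT_comp (measurable_powR _)). Qed.

Lemma measurable_truncated_power (R : realType) (alpha a b : R) :
  measurable_fun setT (truncated_power alpha a b).
Proof.
by apply/(measurable_restrictT _ (measurable_itv _)); exact: measurable_funTS.
Qed.

(** Once eps is smaller than the distance from x to the support, the truncation
    removes nothing from the integral: no limit is left to compute. *)
Lemma hilbert_truncated_power (R : realType) (alpha a b x : R) :
  ~ `[a, b]%classic x ->
  hilbert (truncated_power alpha a b) x =
  pi^-1 * \int[lebesgue_measure]_(y in `[a, b]) (y `^ alpha / (x - y)).
Proof.
rewrite /= in_itv/= => xab; congr (_ * _).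
have [d d0 dP] : exists2 d : R, 0 < d & forall y, `[a, b]%classic y -> d <= `|x - y|.
  have [xa|ax] := ltP x a.
    exists (a - x); first by rewrite subr_gt0.
    by move=> y /=; rewrite in_itv/= => /andP[ay _]; rewrite distrC ler_normr; lra.
  have bx : b < x by rewrite ltNge; apply/negP => xb; apply: xab; rewrite ax.
  exists (x - b); first by rewrite subr_gt0.
  by move=> y /=; rewrite in_itv/= => /andP[_ yb]; rewrite ler_normr; lra.
apply: lim_near_cst; first exact: Rhausdorff.
near=> eps.
rewrite /truncated_integral Rintegral_mkcond [RHS]Rintegral_mkcond.
apply: eq_Rintegral => y _; rewrite !patchE.
have [yab|yab] := pselect (`[a, b]%classic y).
  rewrite (mem_set yab) mem_set ?truncated_powerE//=.
  apply: lt_le_trans (dP _ yab); near: eps; exact: nbhs_right_lt.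
by rewrite (memNset yab) truncated_power0// mul0r if_same.
Unshelve. all: by end_near. Qed.

(** The kernel 1 / (x - y) keeps the sign sg when y ranges over [a, b], so
    |H f(x)| is 1 / pi times the integral of y^alpha / |x - y|, whose integrand
    is at least 1 / (2 y) by the hypothesis on |x - y|. *)
Lemma hilbert_truncated_power_ge (R : realType) (alpha a b x : R) :
  0 < a -> a < b -> ~ `[a, b]%classic x ->
  (forall y : R, `[a, b]%classic y -> `|x - y| <= 2 * y `^ (alpha + 1)) ->
  (ln b - ln a) / (2 * pi) <= `|hilbert (truncated_power alpha a b) x|.
Proof.
move=> a0 ab xab xy.
rewrite hilbert_truncated_power// normrM gtr0_norm ?invr_gt0 ?pi_gt0//.
have -> : (ln b - ln a) / (2 * pi) = pi^-1 * (2^-1 * (ln b - ln a)) :> R.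
  by rewrite invfM; ring.
rewrite ler_pM2l ?invr_gt0 ?pi_gt0//.
set g := fun y => y `^ alpha / (x - y).
have y0 y : `[a, b]%classic y -> 0 < y.
  by rewrite /= in_itv/= => /andP[ay _]; exact: lt_le_trans ay.
have xy0 y : `[a, b]%classic y -> x - y != 0.
  by move=> yab; rewrite subr_eq0; apply/eqP => xE; apply: xab; rewrite xE.
have ig : lebesgue_measure.-integrable `[a, b] (EFin \o g).
  apply: continuous_compact_integrable; first exact: segment_compact.
  apply: derivable_within_continuous => y yab; apply: derivableM.
    by apply: derivable_powR_gt0; exact: y0.
  by apply: derivableV; [exact: xy0|exact: derivableB].
have iinv : lebesgue_measure.-integrable `[a, b] (EFin \o (fun y : R => y `^ (-1))).
  apply: continuous_compact_integrable; first exact: segment_compact.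
  apply: derivable_within_continuous => y yab.
  by apply: derivable_powR_gt0; exact: y0.
have [sg sgN sgE] : exists2 sg : R, `|sg| = 1 &
    forall y, `[a, b]%classic y -> `|x - y| = sg * (x - y).
  move: xab; rewrite /= in_itv/= => xab.
  have [xa|ax] := ltP x a.
    exists (-1); first by rewrite normrN1.
    move=> y /=; rewrite in_itv/= => /andP[ay _].
    by rewrite ltr0_norm ?mulN1r//; lra.
  have bx : b < x by rewrite ltNge; apply/negP => xb; apply: xab; rewrite ax.
  exists 1; first by rewrite normr1.
  move=> y /=; rewrite in_itv/= => /andP[_ yb].
  by rewrite gtr0_norm ?mul1r//; lra.
have -> : 2^-1 * (ln b - ln a) =
    \int[lebesgue_measure]_(y in `[a, b]) (2^-1 * y `^ (-1)).
  by rewrite RintegralZl// /Rintegral integral_powRN1.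
rewrite -[leRHS]mul1r -[X in _ <= X * _]sgN -normrM -RintegralZl//.
apply: le_trans (ler_norm _).
apply: le_Rintegral => //.
  exact: (integrableZl _ 2^-1 iinv).
  exact: (integrableZl _ sg ig).
move=> y yab; have yp := y0 _ yab.
have d0 : 0 < `|x - y| by rewrite normr_gt0 xy0.
have -> : sg * g y = y `^ alpha / `|x - y|.
  rewrite sgE// invfM /g.
  have -> : sg^-1 = sg; last by ring.
  have sg0 : sg != 0 by rewrite -normr_eq0 sgN oner_eq0.
  apply: (mulfI sg0); rewrite mulfV// -expr2 -[LHS](expr1n _ 2) -sgN.
  by rewrite real_normK// num_real.
rewrite ler_pdivlMr// (le_trans (ler_wpM2l _ (xy y yab)))//.
  by rewrite mulr_ge0 ?powR_ge0.
rewrite mulrACA mulVf// mul1r -powRD; last by apply/implyP => _; rewrite gt_eqF.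
by rewrite addrCA addNr addr0.
Qed.

(** * Estimates of Morrey norms *)

Lemma weak_morrey_norm_ge (R : realType) (p lambda x r t : R) (w g : R -> R) :
  0 < r -> 0 < t -> (forall y : R, ball x r y -> t < `|g y|) ->
  (((t `^ p / r `^ lambda)%:E * weighted_measure w (ball x r)) `^ p^-1
   <= weak_morrey_norm p lambda w g)%E.
Proof.
move=> r0 t0 gt; apply: ereal_sup_ubound; exists x, r, t; split => //.
congr ((_ * weighted_measure w _) `^ _)%E.
by apply/seteqP; split => [y xy|y []]//=; split => //; exact: gt.
Qed.

Lemma morrey_norm_le (R : realType) (p lambda K : R) (w f : R -> R) :
  0 < p -> 0 <= K -> (forall y : R, 0 <= w y) ->
  (forall x r : R, (0 < r)%R ->
    \int[lebesgue_measure]_(y in ball x r) (`|f y| `^ p * w y)%:E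
    <= (K * r `^ lambda)%:E)%E ->
  (morrey_norm p lambda w f <= (K `^ p^-1)%:E)%E.
Proof.
move=> p0 K0 w0 H; apply: ge_ereal_sup => _ [x [r [r0 ->]]].
rewrite -poweR_EFin; apply: gt0_ler_poweR.
- by rewrite invr_ge0 ltW.
- rewrite in_itv/= leey andbT mule_ge0 ?lee_fin ?invr_ge0 ?powR_ge0//.
  by apply: integral_ge0 => y _; rewrite lee_fin mulr_ge0 ?powR_ge0.
- by rewrite in_itv/= leey andbT lee_fin.
- rewrite lee_pdivrMl ?powR_gt0//.
  by rewrite -EFinM mulrC; exact: H.
Qed.

Lemma integral_truncated_power_le (R : realType) (p alpha beta s a b x r : R) :
  0 < p -> 0 < a ->
  (forall y : R, `[a, b]%classic y -> (y `^ alpha) `^ p * y `^ beta <= y `^ s) ->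
  (\int[lebesgue_measure]_(y in ball x r)
     (`|truncated_power alpha a b y| `^ p * power_weight beta y)%:E
   <= \int[lebesgue_measure]_(y in ball x r `&` `[a, b]) (y `^ s)%:E)%E.
Proof.
move=> p0 a0 H.
rewrite [leRHS]integral_mkcondr; apply: ge0_le_integral => //.
- exact: measurable_ball.
- by move=> y _; rewrite lee_fin mulr_ge0 ?powR_ge0.
- apply/measurable_EFinP/measurable_funTS/measurable_funM.
    apply: (measurableT_comp (measurable_powR _)).
    by apply: measurableT_comp => //; exact: measurable_truncated_power.
  exact: measurable_power_weight.
- apply: measurable_funTS; apply/(measurable_restrictT _ (measurable_itv _)).
  by apply/measurable_EFinP/measurable_funTS.
- move=> y _; rewrite patchE.
  have [yab|yab] := pselect (`[a, b]%classic y).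
    rewrite (mem_set yab) truncated_powerE// lee_fin ger0_norm ?powR_ge0//.
    rewrite /power_weight ger0_norm ?H//.
    by move: yab; rewrite /= in_itv/= => /andP[ay _]; rewrite (le_trans (ltW a0)).
  by rewrite (memNset yab) truncated_power0// normr0 powR0 ?gt_eqF// mul0r.
Qed.

(** The part of the ball in [a, b] lies in [a', a' + 2 r], where
    a' = max(a, x - r) > 0.  There the integral is
    ((a' + 2 r)^s - a'^s) / s, at most (2 r)^s / s by subadditivity.  The bound
    depends neither on x nor on the segment. *)
Lemma integral_ball_powR_le (R : realType) (s a b x r : R) :
  0 < s -> s <= 1 -> 0 < a -> 0 < r ->
  (\int[lebesgue_measure]_(y in ball x r `&` `[a, b]) (y `^ (s - 1))%:E
   <= (2 `^ s / s * r `^ s)%:E)%E.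
Proof.
move=> s0 s1 a0 r0; set a' := Num.max a (x - r).
have a'0 : 0 < a' by rewrite lt_max a0.
have r20 : 0 < 2 * r by rewrite mulr_gt0.
apply: (@le_trans _ _
    (\int[lebesgue_measure]_(y in `[a', (a' + 2 * r)%R]) (y `^ (s - 1))%:E)%E).
  apply: ge0_subset_integral => //.
  - by apply: measurableI => //; exact: measurable_ball.
  - by apply/measurable_EFinP/measurable_funTS.
  - by move=> y _; rewrite lee_fin powR_ge0.
  - move=> y [+ /=]; rewrite ball_itv/= !in_itv/= => /andP[xy yx] /andP[ay _].
    rewrite ge_max ay (ltW xy)/= (le_trans (ltW yx))//.
    have : x - r <= a' by rewrite le_max lexx orbT.
    lra.
rewrite integral_powR ?gt_eqF// ?ltrDl//.
rewrite lee_fin mulrAC -powRM ?(ltW r0)// ler_pM2r ?invr_gt0//.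
by rewrite lerBlDl powRD_le.
Qed.

Lemma morrey_norm_truncated_power_le (R : realType)
    (p lambda alpha beta a b : R) :
  0 < p -> 0 < lambda -> lambda < 1 -> 0 < a ->
  (forall y : R, `[a, b]%classic y ->
    (y `^ alpha) `^ p * y `^ beta <= y `^ (lambda - 1)) ->
  (morrey_norm p lambda (power_weight beta) (truncated_power alpha a b)
   <= ((2 `^ lambda / lambda) `^ p^-1)%:E)%E.
Proof.
move=> p0 l0 l1 a0 H; apply: morrey_norm_le => //.
- by rewrite divr_ge0 ?powR_ge0 ?ltW.
- by move=> y; exact: powR_ge0.
- move=> x r r0; apply: le_trans (integral_truncated_power_le _ _ p0 a0 H) _.
  by apply: integral_ball_powR_le => //; exact: ltW.
Qed.

(** For lambda = 0 the supremum over balls is at most the integral over the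
    whole support. *)
Lemma morrey0_norm_truncated_power_le (R : realType)
    (p alpha beta s M a b : R) :
  0 < p -> 0 < a ->
  (forall y : R, `[a, b]%classic y -> (y `^ alpha) `^ p * y `^ beta <= y `^ s) ->
  (\int[lebesgue_measure]_(y in `[a, b]) (y `^ s)%:E <= M%:E)%E ->
  (morrey_norm p 0 (power_weight beta) (truncated_power alpha a b)
   <= (M `^ p^-1)%:E)%E.
Proof.
move=> p0 a0 H HM; apply: morrey_norm_le => //.
- rewrite -lee_fin; apply: le_trans HM.
  by apply: integral_ge0 => y _; rewrite lee_fin powR_ge0.
- by move=> y; exact: powR_ge0.
- move=> x r r0; apply: le_trans (integral_truncated_power_le _ _ p0 a0 H) _.
  rewrite powRr0 mulr1; apply: le_trans HM; apply: ge0_subset_integral => //.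
  - by apply: measurableI => //; exact: measurable_ball.
  - by apply/measurable_EFinP/measurable_funTS.
  - by move=> y _; rewrite lee_fin powR_ge0.
Qed.

(** * Unboundedness along the test functions *)

Lemma lebesgue_ball_half (R : realType) (x : R) :
  lebesgue_measure (ball x (2^-1 : R)) = 1%E.
Proof. by rewrite lebesgue_measure_ball ?invr_ge0//; congr (_%:E); lra. Qed.

(** The superlevel set of |H f| at height (ln b - ln a) / (4 pi) contains the whole
    ball; halving the bound L / (2 pi) makes the inequality strict.  The
    weighted measure of the ball is kept as a factor because it may be
    infinite. *)
Lemma weak_morrey_norm_hilbert_ge (R : realType)
    (p lambda alpha a b x0 : R) (w : R -> R) :
  0 <= lambda -> 0 < a -> a < b -> 0 < p -> (forall y : R, 0 <= w y) ->
  (forall x : R, ball x0 (2^-1 : R) x -> ~ `[a, b]%classic x) ->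
  (forall x y : R, ball x0 (2^-1 : R) x -> `[a, b]%classic y ->
    `|x - y| <= 2 * y `^ (alpha + 1)) ->
  (((((ln b - ln a) / (4 * pi)) `^ p)%:E *
      weighted_measure w (ball x0 (2^-1)%R)) `^ p^-1
   <= weak_morrey_norm p lambda w (hilbert (truncated_power alpha a b)))%E.
Proof.
move=> l0 a0 ab p0 w0 xab xy; set t := (ln b - ln a) / (4 * pi).
have h0 : (0 : R) < 2^-1 by rewrite invr_gt0.
have L0 : 0 < ln b - ln a.
  by rewrite subr_gt0 ltr_ln ?posrE//; exact: lt_trans ab.
have t0 : 0 < t by rewrite divr_gt0 ?mulr_gt0 ?pi_gt0.
have w_ge0 : (0 <= weighted_measure w (ball x0 (2^-1)%R))%E.
  by apply: integral_ge0 => y _; rewrite lee_fin.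
apply: le_trans (@weak_morrey_norm_ge _ p lambda x0 2^-1 t w _ h0 t0 _).
  apply: gt0_ler_poweR; rewrite ?in_itv/= ?leey ?andbT.
  - by rewrite invr_ge0 ltW.
  - by rewrite mule_ge0// lee_fin powR_ge0.
  - by rewrite mule_ge0// lee_fin divr_ge0 ?powR_ge0.
  (* The ball has radius 1/2, and dividing by (1/2)^lambda <= 1 only helps. *)
  - rewrite lee_wpmul2r// lee_fin ler_pdivlMr ?powR_gt0//.
    rewrite ler_piMr ?powR_ge0//.
    have : 2^-1 `^ lambda <= 1 `^ lambda :> R; last by rewrite powR1.
    by rewrite ge0_ler_powR ?nnegrE ?(ltW h0)//; lra.
move=> x xball.
apply: lt_le_trans (hilbert_truncated_power_ge a0 ab (xab _ xball) _).
  rewrite ltr_pM2l// ltf_pV2 ?posrE ?mulr_gt0 ?pi_gt0//.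
  by rewrite ltr_pM2r ?pi_gt0// ltr_nat.
by move=> y; exact: xy.
Qed.

Lemma weighted_measure_ball_half_ge1 (R : realType) (beta x0 : R) :
  (forall x : R, ball x0 (2^-1 : R) x -> 1 <= power_weight beta x) ->
  (1 <= weighted_measure (power_weight beta) (ball x0 (2^-1)%R))%E.
Proof.
move=> H; rewrite -(lebesgue_ball_half x0) -[leLHS]mul1e.
rewrite -integral_cst; last exact: measurable_ball.
apply: ge0_le_integral => //.
- exact: measurable_ball.
- apply/measurable_EFinP/measurable_funTS.
  exact: measurable_power_weight.
Qed.

(** The core of the argument: L parametrizes test functions of logarithmic
    length L.  The weak norms of their transforms grow at least linearly in L
    and their own norms at most like L^theta. *)
Lemma hilbert_weak_unbounded (R : realType) (p lambda beta theta K alpha x0 : R)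
    (a b : R -> R) :
  0 < p -> 0 <= lambda -> theta < 1 ->
  (forall L, 0 < L -> [/\ 0 < a L, a L < b L & ln (b L) - ln (a L) = L]) ->
  (forall L x : R, 0 < L -> ball x0 (2^-1 : R) x -> ~ `[a L, b L]%classic x) ->
  (forall L x y : R, 0 < L -> ball x0 (2^-1 : R) x -> `[a L, b L]%classic y ->
    `|x - y| <= 2 * y `^ (alpha + 1)) ->
  (forall x : R, ball x0 (2^-1 : R) x -> 1 <= power_weight beta x) ->
  (forall L, (0 < L)%R -> (morrey_norm p lambda (power_weight beta)
      (truncated_power alpha (a L) (b L)) <= (K * L `^ theta)%:E)%E) ->
  ~ hilbert_weak_bounded p lambda (power_weight beta).
Proof.
move=> p0 l0 t1 abL xab xy w1 HK [_ [C [C0 HC]]].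
have [L [L0 LD]] := powR_sublinear (C * K * (4 * pi)) t1.
have [aL0 aLb lnL] := abL _ L0.
have pi40 : 0 < 4 * pi :> R by rewrite mulr_gt0 ?pi_gt0.
have /HC : morrey_space p lambda (power_weight beta)
    (truncated_power alpha (a L) (b L)).
  split; first exact: measurable_truncated_power.
  by rewrite (le_lt_trans (HK _ L0))// ltry.
apply/negP; rewrite -ltNge.
apply: (@le_lt_trans _ _ (C%:E * (K * L `^ theta)%:E)%E).
  by apply: lee_wpmul2l; [rewrite lee_fin|exact: HK].
have := @weak_morrey_norm_hilbert_ge _ p lambda alpha _ _ x0
  (power_weight beta) l0 aL0 aLb p0 (fun y => powR_ge0 _ _)
  (fun x => @xab L x L0) (fun x y => @xy L x y L0).
apply: lt_le_trans; rewrite lnL.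
apply: (@lt_le_trans _ _ (L / (4 * pi))%:E).
  rewrite -EFinM lte_fin ltr_pdivlMr//.
  by have -> : C * (K * L `^ theta) * (4 * pi) = C * K * (4 * pi) * L `^ theta
    by ring.
have t0 : 0 <= L / (4 * pi) by rewrite divr_ge0 ?ltW.
have -> : (L / (4 * pi))%:E = (((L / (4 * pi)) `^ p)%:E `^ p^-1)%E.
  by rewrite poweR_EFin -powRrM mulfV ?gt_eqF// powRr1.
have w_ge1 := weighted_measure_ball_half_ge1 w1.
have tp0 : (0 <= ((L / (4 * pi)) `^ p)%:E)%E by rewrite lee_fin powR_ge0.
have tw : (((L / (4 * pi)) `^ p)%:E <= ((L / (4 * pi)) `^ p)%:E *
    weighted_measure (power_weight beta) (ball x0 (2^-1)%R))%E.
  by rewrite -[leLHS]mule1 lee_wpmul2l.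
by apply: gt0_ler_poweR; rewrite ?in_itv/= ?leey ?andbT ?invr_ge0 ?(ltW p0)//;
  exact: le_trans tw.
Qed.

(** * The two bounds on the exponent *)

(** Uses y^(-1) on [e^(-L), 1], tested on the ball (1, 2).  The exponent theta
    is 1/p if lambda = 0 and p > 1, and 0 otherwise. *)
Lemma hilbert_weak_bounded_lt (R : realType) (p lambda beta : R) :
  1 <= p -> 0 <= lambda -> lambda < 1 ->
  ~ [/\ p = 1, lambda = 0 & beta = 0] ->
  hilbert_weak_bounded p lambda (power_weight beta) ->
  beta < lambda + p - 1.
Proof.
move=> p1 l0 l1 corner hH; rewrite ltNge; apply/negP => bge.
have p0 : 0 < p by rewrite (lt_le_trans ltr01).
have abL (L : R) : 0 < L ->
    [/\ 0 < expR (- L), expR (- L) < 1 & ln 1 - ln (expR (- L)) = L].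
  by move=> L0; rewrite expR_gt0 expR_lt1 oppr_lt0 ln1 expRK sub0r opprK.
have ballP (x : R) : ball (3 / 2 : R) (2^-1 : R) x -> 1 < x < 2.
  by rewrite ball_itv/= in_itv/= => /andP[? ?]; apply/andP; split; lra.
have xab (L x : R) : 0 < L -> ball (3 / 2 : R) (2^-1 : R) x ->
    ~ `[expR (- L), 1]%classic x.
  by move=> _ /ballP /andP[x1 _]; rewrite /= in_itv/= [x <= 1]leNgt x1 andbF.
have xy (L x y : R) : 0 < L -> ball (3 / 2 : R) (2^-1 : R) x ->
    `[expR (- L), 1]%classic y -> `|x - y| <= 2 * y `^ (-1 + 1).
  move=> _ /ballP /andP[x1 x2]; rewrite /= in_itv/= => /andP[ey y1].
  have := lt_le_trans (expR_gt0 _) ey => y0.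
  by rewrite addNr powRr0 ler_norml; apply/andP; split; lra.
have w1 (x : R) : ball (3 / 2 : R) (2^-1 : R) x -> 1 <= power_weight beta x.
  move=> /ballP /andP[x1 _].
  rewrite /power_weight -(powRr0 `|x|) ler_powR//; last lra.
  by rewrite ger0_norm; lra.
have pE (L y s : R) : s <= beta - p -> `[expR (- L), 1]%classic y ->
    (y `^ (-1)) `^ p * y `^ beta <= y `^ s.
  move=> sb; rewrite /= in_itv/= => /andP[ey y1].
  have y0 := lt_le_trans (expR_gt0 _) ey.
  rewrite -powRrM -powRD; last by apply/implyP => _; rewrite gt_eqF.
  by rewrite ger_powR ?y0//; lra.
have [l_eq0|l_gt0] : lambda = 0 \/ 0 < lambda.
  by move: l0; rewrite le_eqVlt => /predU1P[<-|]; [left|right].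
- have [p_gt1|p_le1] := ltP 1 p.
  + have pV1 : p^-1 < 1 by rewrite invf_lt1.
    apply: (hilbert_weak_unbounded p0 l0 pV1 abL xab xy w1 (K := 1) _ hH) => L L0.
    rewrite mul1r l_eq0.
    apply: (@morrey0_norm_truncated_power_le _ _ _ _ (-1)) => //.
    * exact: expR_gt0.
    * by move=> y; apply: pE; lra.
    * have [e0 e1 eL] := abL _ L0.
      by rewrite integral_powRN1// eL.
  + have pE1 : p = 1 by apply/eqP; rewrite eq_le p_le1.
    have b0 : 0 < beta.
      have [//|ble] := ltP 0 beta.
      by exfalso; apply: corner; split => //; apply/eqP; rewrite eq_le ble/=; lra.
    apply: (hilbert_weak_unbounded p0 l0 (@ltr01 R) abL xab xy w1
      (K := beta^-1 `^ p^-1) _ hH) => L L0.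
    rewrite powRr0 mulr1 l_eq0.
    apply: (@morrey0_norm_truncated_power_le _ _ _ _ (beta - 1)) => //.
    * exact: expR_gt0.
    * by move=> y; apply: pE; lra.
    * have [e0 e1 eL] := abL _ L0.
      rewrite integral_powR ?gt_eqF// lee_fin ler_pdivrMr// mulVf ?gt_eqF//.
      by rewrite powR1 lerBlDr lerDl powR_ge0.
- apply: (hilbert_weak_unbounded p0 l0 (@ltr01 R) abL xab xy w1
    (K := (2 `^ lambda / lambda) `^ p^-1) _ hH) => L L0.
  rewrite powRr0 mulr1.
  apply: morrey_norm_truncated_power_le => //; first exact: expR_gt0.
  by move=> y; apply: pE; lra.
Qed.

(** On (0, 1) the weight dominates 1 / y, whose integral over
    [e^(-2L), e^(-L)] is L. *)
Lemma weighted_measure_ball_half_eqy (R : realType) (beta : R) : beta <= -1 ->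
  weighted_measure (power_weight beta) (ball (2^-1 : R) 2^-1) = +oo%E.
Proof.
move=> b1; apply/eq_infty => r; set L := `|r| + 1.
have L0 : 0 < L by rewrite ltr_pwDr.
have e12 : expR (- (L + L)) < expR (- L) by rewrite ltr_expR; lra.
apply: (@le_trans _ _ L%:E).
  by rewrite lee_fin /L (le_trans (ler_norm r))// lerDl.
have -> : L%:E = (\int[lebesgue_measure]_(y in `[expR (- (L + L))%R, expR (- L)%R])
    (y `^ (-1))%:E)%E.
  by rewrite integral_powRN1 ?expR_gt0// !expRK; congr (_%:E); lra.
apply: (@le_trans _ _ (\int[lebesgue_measure]_(y in
    `[expR (- (L + L))%R, expR (- L)%R]) (power_weight beta y)%:E)%E).
  apply: ge0_le_integral => //.
  - by move=> y _; rewrite lee_fin powR_ge0.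
  - by apply/measurable_EFinP/measurable_funTS.
  - apply/measurable_EFinP/measurable_funTS.
    exact: measurable_power_weight.
  - move=> y /=; rewrite in_itv/= => /andP[ey ye].
    have y0 := lt_le_trans (expR_gt0 _) ey.
    rewrite lee_fin /power_weight gtr0_norm// ger_powR// y0/=.
    by rewrite (le_trans ye)// expR_le1; lra.
apply: ge0_subset_integral => //.
- exact: measurable_ball.
- apply/measurable_EFinP/measurable_funTS.
  exact: measurable_power_weight.
- by move=> y _; rewrite lee_fin powR_ge0.
- move=> y /=; rewrite ball_itv/= !in_itv/= => /andP[ey ye].
  have y0 := lt_le_trans (expR_gt0 _) ey.
  have : expR (- L) < 1 by rewrite expR_lt1 oppr_lt0.
  by move=> e1; apply/andP; split; lra.
Qed.

(** Uses the constant 1 on [1, e^L], tested on the ball (0, 1).  For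
    lambda = 0 it is enough to take L = 1, since the ball then has infinite
    weighted measure. *)
Lemma hilbert_weak_bounded_gt (R : realType) (p lambda beta : R) :
  1 <= p -> 0 <= lambda -> lambda < 1 ->
  hilbert_weak_bounded p lambda (power_weight beta) ->
  lambda - 1 < beta.
Proof.
move=> p1 l0 l1 hH; rewrite ltNge; apply/negP => ble.
have p0 : 0 < p by rewrite (lt_le_trans ltr01).
have abL (L : R) : 0 < L ->
    [/\ (0 : R) < 1, 1 < expR L & ln (expR L) - ln 1 = L].
  by move=> L0; rewrite expR_gt1 ln1 expRK subr0.
have ballP (x : R) : ball (2^-1 : R) (2^-1 : R) x -> 0 < x < 1.
  by rewrite ball_itv/= in_itv/= => /andP[? ?]; apply/andP; split; lra.
have xab (L x : R) : 0 < L -> ball (2^-1 : R) (2^-1 : R) x ->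
    ~ `[1, expR L]%classic x.
  by move=> _ /ballP /andP[_ x1]; rewrite /= in_itv/= leNgt x1.
have xy (L x y : R) : 0 < L -> ball (2^-1 : R) (2^-1 : R) x ->
    `[1, expR L]%classic y -> `|x - y| <= 2 * y `^ (0 + 1).
  move=> _ /ballP /andP[x0 x1]; rewrite /= in_itv/= => /andP[y1 _].
  rewrite add0r powRr1; last lra.
  by rewrite ler_norml; apply/andP; split; lra.
have pE (L y s : R) : beta <= s -> `[1, expR L]%classic y ->
    (y `^ 0) `^ p * y `^ beta <= y `^ s.
  move=> sb; rewrite /= in_itv/= => /andP[y1 _].
  by rewrite powRr0 powR1 mul1r ler_powR.
have [l_eq0|l_gt0] : lambda = 0 \/ 0 < lambda.
  by move: l0; rewrite le_eqVlt => /predU1P[<-|]; [left|right].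
- have [_ e1 eL] := abL _ (@ltr01 R).
  have Hf : (morrey_norm p lambda (power_weight beta)
      (truncated_power 0 1 (expR 1)) <= (1 `^ p^-1)%:E)%E.
    rewrite l_eq0; apply: (@morrey0_norm_truncated_power_le _ _ _ _ (-1)) => //.
    + by move=> y; apply: pE; lra.
    + by rewrite integral_powRN1// eL.
  case: hH => _ [C [C0 HC]].
  have /HC : morrey_space p lambda (power_weight beta)
      (truncated_power 0 1 (expR 1)).
    split; first exact: measurable_truncated_power.
    by rewrite (le_lt_trans Hf)// ltry.
  apply/negP; rewrite -ltNge.
  apply: (@le_lt_trans _ _ (C%:E * (1 `^ p^-1)%:E)%E).
    by apply: lee_wpmul2l => //; rewrite lee_fin.
  have := @weak_morrey_norm_hilbert_ge _ p lambda 0 _ _ (2^-1)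
    (power_weight beta) l0 ltr01 e1 p0 (fun y => powR_ge0 _ _)
    (fun x => @xab 1 x ltr01) (fun x y => @xy 1 x y ltr01).
  apply: lt_le_trans; rewrite weighted_measure_ball_half_eqy; last lra.
  rewrite eL gt0_muley ?lte_fin ?powR_gt0 ?divr_gt0 ?mulr_gt0 ?pi_gt0//.
  by rewrite poweRyr ?invr_eq0 ?gt_eqF// -EFinM ltry.
- have w1 (x : R) : ball (2^-1 : R) (2^-1 : R) x -> 1 <= power_weight beta x.
    move=> /ballP /andP[x0 x1].
    by rewrite /power_weight -(powRr0 `|x|) gtr0_norm// ger_powR ?x0 ?ltW//; lra.
  apply: (hilbert_weak_unbounded p0 l0 (@ltr01 R) abL xab xy w1
    (K := (2 `^ lambda / lambda) `^ p^-1) _ hH) => L L0.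
  rewrite powRr0 mulr1.
  apply: morrey_norm_truncated_power_le => //.
  by move=> y; apply: pE; lra.
Qed.

Unset Implicit Arguments.

Theorem proposition5p6 (R : realType) (p lambda beta : R)
  (hp : 1 <= p) (hlambda0 : 0 <= lambda) (hlambda1 : lambda < 1)
  (hcorner : ~ [/\ p = 1, lambda = 0 & beta = 0])
  (hH : hilbert_weak_bounded p lambda (power_weight beta)) :
  lambda - 1 < beta /\ beta < lambda + p - 1.
Proof.
split; first exact: hilbert_weak_bounded_gt hH.
exact: hilbert_weak_bounded_lt hH.
Qed.
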